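(* Let $K$ be an algebraic number field such that $\mathbb{Q}\subset K$ is a Galois extension, let $\mathcal{O}_K$ be its ring of algebraic integers, and let $p$ and $q$ be two distinct prime positive integers such that $\omega(p\mathcal{O}_K)=\omega(q\mathcal{O}_K)$. Then $$D\left(p\mathcal{O}_K||q\mathcal{O}_K\right)=0.$$
   Context: $\log$ is the natural logarithm. For a nonzero ideal $I$ of $\mathcal{O}_K$ with factorization $I=P_1^{e_1}\cdots P_g^{e_g}$ into powers of distinct prime ideals ($e_i\geq 1$), $\omega(I)=g$ is the number of distinct prime ideal factors and $\Omega(I)=e_1+\dots+e_g$. For two nonzero ideals $I=P_1^{e_1}\cdots P_g^{e_g}$ and $J=Q_1^{f_1}\cdots Q_g^{f_g}$ of $\mathcal{O}_K$ with the same number $g$ of distinct prime factors ($P_i$ distinct prime ideals, $Q_i$ distinct prime ideals, $e_i,f_i\geq 1$), the divergence of $I$ and $J$ is $$D(I||J)=\log\frac{\Omega(J)}{\Omega(I)}-\frac{1}{\Omega(I)}\sum_{i=1}^g e_i\log\frac{f_i}{e_i}.$$ *)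

(* Defs.v *)
From HB Require Import structures.
From mathcomp Require Import all_boot all_order all_algebra all_field.
From mathcomp Require Import all_classical all_reals all_analysis.

Set Implicit Arguments.
Unset Strict Implicit.
Unset Printing Implicit Defensive.

Import Order.TTheory GRing.Theory Num.Theory.

Local Open Scope classical_set_scope.
Local Open Scope ring_scope.

Section RingOfIntegers.
Variable K : fieldExtType rat.

Definition algebraic_integers : {pred K} :=
  fun x => `[< integralOver (intmul (1 : K)) x >].

Lemma algebraic_integers_subring : subring_closed algebraic_integers.
Proof.
split=> [|x y /asboolP ix /asboolP iy|x y /asboolP ix /asboolP iy].
- by apply/asboolP; apply: integral1.
- by apply/asboolP; apply: integral_sub.
- by apply/asboolP; apply: integral_mul.
Qed.

HB.instance Definition _ :=
  GRing.isSubringClosed.Build K algebraic_integers algebraic_integers_subring.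

Record ring_of_integers := RingOfIntegers {
  integer_val :> K;
  integer_valP : integer_val \in algebraic_integers
}.

HB.instance Definition _ := [isSub for integer_val].
HB.instance Definition _ := [Choice of ring_of_integers by <:].
HB.instance Definition _ := [SubChoice_isSubComNzRing of ring_of_integers by <:].

End RingOfIntegers.

Arguments algebraic_integers K : clear implicits.

Section Ideals.
Variable A : comNzRingType.
Implicit Types I J P : set A.

Definition principal_ideal (a : A) : set A := [set x | exists y, x = a * y].

Definition ideal_mul I J : set A :=
  [set x | exists n (a b : 'I_n -> A),
     [/\ forall i, I (a i), forall i, J (b i) & x = \sum_(i < n) a i * b i]].

Definition ideal_exp I (n : nat) : set A := iter n (ideal_mul I) setT.

(* [idealr_closed] already includes properness (1 is not in the ideal). *)
Definition prime_ideal P : Prop :=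
  idealr_closed (mem P) /\ prime_idealr_closed (mem P).

Definition prime_factorization I (g : nat) (P : 'I_g -> set A)
    (e : 'I_g -> nat) : Prop :=
  [/\ forall i, prime_ideal (P i),
      injective P,
      forall i, (0 < e i)%N
    & I = \big[ideal_mul/setT]_(i < g) ideal_exp (P i) (e i)].

(* [omega] and [Omega] are read off any prime factorization of [I]; they take
   the junk value 0 when [I] has none, which does not happen for a nonzero
   ideal of the ring of integers of a number field. *)
Definition omega I : nat :=
  xget 0%N [set g | exists (P : 'I_g -> set A) (e : 'I_g -> nat),
                      prime_factorization I P e].

Definition Omega I : nat :=
  xget 0%N [set n | exists g (P : 'I_g -> set A) (e : 'I_g -> nat),
                      prime_factorization I P e /\ n = (\sum_(i < g) e i)%N].

(* The formula for D(I||J) depends a priori on how the prime factors of I are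
   paired with those of J, i.e. on the chosen indexings of the two
   factorizations.  [divergence R I J] is the set of all the values it takes;
   "D(I||J) = d" means that this set is [set d]: the divergence is defined and
   equals d for every choice of the indexings. *)
Definition divergence (R : realType) I J : set R :=
  [set d | exists g (P Q : 'I_g -> set A) (e f : 'I_g -> nat),
     [/\ prime_factorization I P e,
         prime_factorization J Q f
       & d = ln ((Omega J)%:R / (Omega I)%:R)
             - (Omega I)%:R^-1
               * \sum_(i < g) (e i)%:R * ln ((f i)%:R / (e i)%:R)]].

End Ideals.

Arguments divergence {A} R I J.

(* Main.v *)
(* Fix a prime p. The ring O_K has finitely many residues modulo p, and p b^k
   in p^k O_K for all k forces b in p O_K. Hence a prime Q above p is maximal
   and invertible: an associated prime of O_K/p is, up to Galois conjugation, Q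
   itself, so b Q lies in p O_K for some b outside p O_K, and b/p lies in the
   inverse of Q without stabilising Q. As the Galois group permutes the primes
   Q_1, ..., Q_g above p transitively, the largest e with p in Q_i^e does not
   depend on i, and p O_K = (Q_1 ... Q_g)^e, a factorization that is unique by
   cancellation. If p and q have the same g, with exponents e and f, then
   D = ln (gf / ge) - (1 / ge) g e ln (f / e) = 0. *)
Require Import Defs.
From HB Require Import structures.
From mathcomp Require Import all_boot all_order all_algebra all_field.
From mathcomp Require Import all_classical all_reals all_analysis.
From mathcomp Require Import ring.

Set Implicit Arguments.
Unset Strict Implicit.
Unset Printing Implicit Defensive.

Import Order.TTheory GRing.Theory Num.Theory.

Local Open Scope classical_set_scope.
Local Open Scope ring_scope.

(** * Ideals as sets: products, powers, primality *)

Section IdealArithmetic.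
Variable A : comNzRingType.
Implicit Types (I J L P Q : set A) (a b x y z : A).

Definition is_ideal I : Prop :=
  [/\ I 0, forall x y, I x -> I y -> I (x + y) & forall a x, I x -> I (a * x)].

Lemma is_ideal_setT : is_ideal setT.
Proof. by split. Qed.

Lemma is_ideal_principal a : is_ideal (principal_ideal a).
Proof.
split=> [|x y [u ->] [v ->]|b x [u ->]]; first by exists 0; rewrite mulr0.
- by exists (u + v); rewrite mulrDr.
- by exists (b * u); rewrite mulrCA.
Qed.

Lemma principal_refl a : principal_ideal a a.
Proof. by exists 1; rewrite mulr1. Qed.

Lemma is_idealN I x : is_ideal I -> I x -> I (- x).
Proof. by case=> _ _ IM Ix; rewrite -mulN1r; apply: IM. Qed.

Lemma is_idealB I x y : is_ideal I -> I x -> I y -> I (x - y).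
Proof. by move=> idI Ix Iy; case: (idI) => _ ID _; apply: ID => //; apply: is_idealN. Qed.

Lemma is_idealBr I x y : is_ideal I -> I (x - y) -> I y -> I x.
Proof. by move=> [_ ID _] Ixy Iy; rewrite -(subrK y x); apply: ID. Qed.

Lemma is_idealMr I x a : is_ideal I -> I x -> I (x * a).
Proof. by case=> _ _ IM Ix; rewrite mulrC; apply: IM. Qed.

Lemma ideal_sum I (T : Type) (r : seq T) (F : T -> A) :
  is_ideal I -> (forall t, I (F t)) -> I (\sum_(t <- r) F t).
Proof. by move=> [I0 ID _] IF; elim/big_ind: _. Qed.

Lemma principal_sub I a : is_ideal I -> I a -> principal_ideal a `<=` I.
Proof. by move=> idI Ia _ [y ->]; apply: is_idealMr. Qed.

Lemma is_ideal_transporter I L :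
  is_ideal L -> is_ideal [set x | forall y, I y -> L (x * y)].
Proof.
move=> [L0 LD LM]; split=> [y _|x x' Lx Lx' y Iy|a x Lx y Iy] /=.
- by rewrite mul0r.
- by rewrite mulrDl; apply: LD; [apply: Lx|apply: Lx'].
- by rewrite -mulrA; apply/LM/Lx.
Qed.

Lemma is_ideal_colon I a : is_ideal I -> is_ideal [set x | I (x * a)].
Proof.
move=> [I0 ID IM]; split=> [|x y|b x]; rewrite /= ?mul0r ?mulrDl -?mulrA //.
- exact: ID.
- exact: IM.
Qed.

Lemma is_ideal_scale I a : is_ideal I -> is_ideal [set a * x | x in I].
Proof.
move=> [I0 ID IM]; split=> [|_ _ [x Ix <-] [y Iy <-]|b _ [x Ix <-]].
- by exists 0; rewrite ?mulr0.
- by exists (x + y); [apply: ID|rewrite mulrDr].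
- by exists (b * x); [apply: IM|rewrite mulrCA].
Qed.

Lemma mem_ideal_mul I J a b : I a -> J b -> ideal_mul I J (a * b).
Proof. by move=> Ia Jb; exists 1, (fun=> a), (fun=> b); rewrite big_ord1. Qed.

(** Elements of a product are finite sums, so a condition that cuts out an ideal need only be tested
    on single products; [is_ideal_colon] and [is_ideal_scale] supply the ideals used for this. *)
Lemma ideal_mul_sub I J L : is_ideal L ->
  (forall a b, I a -> J b -> L (a * b)) -> ideal_mul I J `<=` L.
Proof.
by move=> idL IJL _ [n [a [b [Ia Jb ->]]]]; apply: ideal_sum => // i; apply: IJL.
Qed.

Lemma is_ideal_mul I J : is_ideal I -> is_ideal (ideal_mul I J).
Proof.
move=> idI; split=> [|_ _ [m [a [b [Ia Jb ->]]]] [n [c [d [Ic Jd ->]]]]|].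
- by exists 0, (fun=> 0), (fun=> 0); split; rewrite ?big_ord0 // => -[].
- exists (m + n)%N, (fun i => match fintype.split i with inl j => a j | inr j => c j end),
    (fun i => match fintype.split i with inl j => b j | inr j => d j end).
  split=> [i|i|]; try by case: fintype.split.
  rewrite big_split_ord /=; congr (_ + _); apply: eq_bigr => i _.
  + by rewrite (unsplitK (inl i : 'I_m + 'I_n)).
  + by rewrite (unsplitK (inr i : 'I_m + 'I_n)).
- move=> x _ [n [a [b [Ia Jb ->]]]]; exists n, (fun i => x * a i), b.
  split=> // [i|]; first by case: idI => _ _; apply.
  by rewrite mulr_sumr; apply: eq_bigr => i _; rewrite mulrA.
Qed.

Lemma is_ideal_exp I n : is_ideal I -> is_ideal (ideal_exp I n).
Proof. by case: n => [|n] idI; [exact: is_ideal_setT|exact: is_ideal_mul]. Qed.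

Lemma ideal_expS I n : ideal_exp I n.+1 = ideal_mul I (ideal_exp I n).
Proof. by []. Qed.

Lemma ideal_mulSl I I' J : I `<=` I' -> ideal_mul I J `<=` ideal_mul I' J.
Proof.
by move=> sI _ [n [a [b [Ia Jb ->]]]]; exists n, a, b; split=> // i; apply: sI.
Qed.

Lemma ideal_mulSr I J J' : J `<=` J' -> ideal_mul I J `<=` ideal_mul I J'.
Proof.
by move=> sJ _ [n [a [b [Ia Jb ->]]]]; exists n, a, b; split=> // i; apply: sJ.
Qed.

Lemma ideal_mul_subr I J : is_ideal J -> ideal_mul I J `<=` J.
Proof. by move=> idJ; apply: ideal_mul_sub => // a b _; case: idJ => _ _; apply. Qed.

Lemma ideal_mulC I J : ideal_mul I J = ideal_mul J I.
Proof.
by apply/seteqP; split=> _ [n [a [b [Ia Jb ->]]]]; exists n, b, a; split=> //;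
   apply: eq_bigr => i _; rewrite mulrC.
Qed.

Lemma ideal_mul_subl I J : is_ideal I -> ideal_mul I J `<=` I.
Proof. by rewrite ideal_mulC; apply: ideal_mul_subr. Qed.

Lemma ideal_mulA I J L : is_ideal I -> is_ideal L ->
  ideal_mul I (ideal_mul J L) = ideal_mul (ideal_mul I J) L.
Proof.
move=> idI idL.
have sub I' J' L' : is_ideal I' ->
    ideal_mul I' (ideal_mul J' L') `<=` ideal_mul (ideal_mul I' J') L'.
  move=> idI'; have idM : is_ideal (ideal_mul (ideal_mul I' J') L').
    by do 2!apply: is_ideal_mul.
  apply: ideal_mul_sub => // a w Ia; rewrite mulrC.
  apply: (ideal_mul_sub (is_ideal_colon a idM)) => b c J'b L'c /=.
  by rewrite mulrC mulrA; do 2!apply: mem_ideal_mul => //.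
apply/seteqP; split; first exact: sub.
rewrite ideal_mulC [ideal_mul I J]ideal_mulC [X in _ `<=` X]ideal_mulC.
by rewrite [ideal_mul J L]ideal_mulC; apply: sub.
Qed.

Lemma ideal_mulACA I I' J J' :
  is_ideal I -> is_ideal I' -> is_ideal J -> is_ideal J' ->
  ideal_mul (ideal_mul I I') (ideal_mul J J') =
  ideal_mul (ideal_mul I J) (ideal_mul I' J').
Proof.
move=> idI idI' idJ idJ'.
have [idJJ' idII'] := (is_ideal_mul J' idJ, is_ideal_mul J' idI').
rewrite -(ideal_mulA _ idI idJJ') (ideal_mulA _ idI' idJ') (ideal_mulC I' J).
by rewrite -(ideal_mulA _ idJ idJ') (ideal_mulA _ idI idII').
Qed.

Lemma ideal_mul_principal a b :
  ideal_mul (principal_ideal a) (principal_ideal b) = principal_ideal (a * b).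
Proof.
apply/seteqP; split.
- apply: ideal_mul_sub => [|_ _ [x ->] [y ->]]; first exact: is_ideal_principal.
  by exists (x * y); rewrite mulrACA.
- apply: principal_sub; first exact/is_ideal_mul/is_ideal_principal.
  by apply: mem_ideal_mul; apply: principal_refl.
Qed.

Lemma ideal_exp_sub I m n : is_ideal I ->
  (m <= n)%N -> ideal_exp I n `<=` ideal_exp I m.
Proof.
move=> idI /subnK <-; elim: (n - m)%N => [//|k IHk].
rewrite addSn ideal_expS; apply: subset_trans IHk; apply: ideal_mul_subr.
exact: is_ideal_exp.
Qed.

Lemma ideal_exp_sub1 I n : is_ideal I -> (0 < n)%N -> ideal_exp I n `<=` I.
Proof. by case: n => // n idI _; apply: ideal_mul_subl. Qed.

Lemma mem_ideal_exp I x n : I x -> ideal_exp I n (x ^+ n).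
Proof.
by move=> Ix; elim: n => [|n IHn] //; rewrite exprS; apply: mem_ideal_mul.
Qed.

Lemma mem_ideal_prod g (F : 'I_g -> set A) (y : 'I_g -> A) :
  (forall i, F i (y i)) -> (\big[@ideal_mul A/setT]_(i < g) F i) (\prod_(i < g) y i).
Proof. by move=> Fy; elim/big_rec2: _ => // i x I _; apply: mem_ideal_mul. Qed.

Lemma is_ideal_prod g (F : 'I_g -> set A) :
  (forall i, is_ideal (F i)) -> is_ideal (\big[@ideal_mul A/setT]_(i < g) F i).
Proof.
by move=> idF; elim/big_rec: _ => [|i I _ _]; [exact: is_ideal_setT|exact: is_ideal_mul].
Qed.

Lemma ideal_prod_sub g (F : 'I_g -> set A) i : (forall i, is_ideal (F i)) ->
  \big[@ideal_mul A/setT]_(i < g) F i `<=` F i.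
Proof.
elim: g F i => [|g IHg] F i idF; first by case: i.
rewrite big_ord_recl; case: (unliftP ord0 i) => [j|] ->.
  apply: subset_trans (IHg (fun j => F (lift ord0 j)) j _) => //.
  by apply: ideal_mul_subr; apply: is_ideal_prod.
exact: ideal_mul_subl.
Qed.

Lemma prime_idealP P : prime_ideal P <->
  [/\ is_ideal P, ~ P 1 & forall x y, P (x * y) -> P x \/ P y].
Proof.
split=> [[[P0 P1 PM] Pp]|[[P0 PD PM] P1 Pp]].
- rewrite in_setE in P0.
  have PM' a x y : P x -> P y -> P (a * x + y).
    by move=> Px Py; have := PM a x y; rewrite !in_setE; apply.
  split=> [|/mem_set|x y Pxy]; last 2 first.
  + exact/negP.
  + by have := Pp x y; rewrite !in_setE => /(_ Pxy)/orP[]; rewrite in_setE; [left|right].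
  split=> // [x y Px Py|a x Px]; first by rewrite -[x]mul1r; apply: PM'.
  by rewrite -[_ * _]addr0; apply: PM'.
- split; first split=> [||a x y].
  + by rewrite in_setE.
  + by apply/negP; rewrite in_setE.
  + by rewrite !in_setE => Px Py; apply/PD => //; apply: PM.
  + by move=> x y; rewrite !in_setE => /Pp[]/mem_set ->; rewrite ?orbT.
Qed.

Lemma prime_is_ideal P : prime_ideal P -> is_ideal P.
Proof. by case/prime_idealP. Qed.

Lemma prime_prod P (T : Type) (r : seq T) (B : pred T) (F : T -> A) :
  prime_ideal P -> (forall t, B t -> ~ P (F t)) -> ~ P (\prod_(t <- r | B t) F t).
Proof.
by case/prime_idealP=> _ P1 Pp nF; elim/big_ind: _ => // x y nx ny /Pp[].
Qed.

Lemma prime_exp P x n : prime_ideal P -> P (x ^+ n) -> P x.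
Proof.
move=> prP; apply: contraPP => nPx; rewrite -[n]card_ord -prodr_const.
exact: prime_prod.
Qed.

Lemma prime_preim (s : {rmorphism A -> A}) P :
  prime_ideal P -> prime_ideal [set x | P (s x)].
Proof.
case/prime_idealP=> -[P0 PD PM] P1 Pp; apply/prime_idealP; split=> /=.
- split=> [|x y|a x] /=; rewrite ?rmorph0 ?rmorphD ?rmorphM //; [exact: PD|exact: PM].
- by rewrite rmorph1.
- by move=> x y; rewrite rmorphM; apply: Pp.
Qed.

Lemma rmorph_ideal_exp (s : {rmorphism A -> A}) I J n x :
  is_ideal J -> (forall y, I y -> J (s y)) -> ideal_exp I n x -> ideal_exp J n (s x).
Proof.
move=> idJ sIJ; elim: n x => [|n IHn] //= _ [m [a [b [Ia Ib ->]]]].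
rewrite rmorph_sum; apply: ideal_sum => [|i]; first exact: is_ideal_mul.
by rewrite rmorphM; apply: mem_ideal_mul; [apply: sIJ|apply: IHn].
Qed.

End IdealArithmetic.

(** * Primes above p when there are finitely many residues modulo p *)

Section FiniteResidueRing.
Variables (A : comNzRingType) (p : nat) (T : finType) (cls : A -> T).
Local Notation pA := (principal_ideal (p%:R : A)).
Hypothesis cls_eq : forall x y, cls x = cls y -> pA (x - y).
Implicit Types (C I J P Q : set A).

(** Pigeonhole on one more value than there are labels. The sequence is arbitrary, so that it can
    also be the numerators of the powers of b / p. *)
Lemma powers_congruent (f : nat -> A) : exists i j, (i < j)%N /\ pA (f j - f i).
Proof.
have /injectivePn[i [j neq_ij eq_ij]] : ~~ injectiveb (fun i : 'I_#|T|.+1 => cls (f i)).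
  by apply/injectiveP => /leq_card; rewrite card_ord ltnn.
have [lt_ij|lt_ji|/val_inj eq_ij'] := ltngtP i j.
- by exists i, j; split=> //; apply: cls_eq.
- by exists j, i; split=> //; apply: cls_eq.
- by rewrite eq_ij' eqxx in neq_ij.
Qed.

Lemma prime_above_maximal Q x :
  prime_ideal Q -> Q p%:R -> ~ Q x -> exists z, Q (x * z - 1).
Proof.
move=> prQ Qp nQx; have [idQ _ Qpr] := (prime_idealP Q).1 prQ.
have [i [j [lt_ij pij]]] := powers_congruent (fun k => x ^+ k).
(* Q contains x^i (x^(j-i) - 1) but not x^i, so x^(j-i-1) inverts x modulo Q. *)
exists (x ^+ (j - i.+1)); rewrite -exprS subnSK //.
have : Q (x ^+ i * (x ^+ (j - i) - 1)).
  by rewrite mulrBr -exprD subnKC ?mulr1 1?ltnW //; apply: principal_sub pij.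
by case/Qpr => // /(prime_exp prQ).
Qed.

Lemma prime_above_eq Q Q' :
  prime_ideal Q -> Q p%:R -> prime_ideal Q' -> Q `<=` Q' -> Q = Q'.
Proof.
move=> prQ Qp prQ' sQQ'; apply/seteqP; split=> // x Q'x; apply: contrapT => nQx.
have [idQ' Q'1 _] := (prime_idealP Q').1 prQ'.
have [z /sQQ' Q'z] := prime_above_maximal prQ Qp nQx; apply: Q'1.
rewrite -(subKr (x * z) 1); apply: is_idealB => //; exact: is_idealMr.
Qed.

(* A maximal proper ideal of the form (C : b) is prime. *)
Lemma prime_transporter C : is_ideal C -> C p%:R -> ~ C 1 ->
  exists2 b, ~ C b & prime_ideal [set x | C (x * b)].
Proof.
move=> idC Cp C1; pose D b := [set x | C (x * b)].
have idD b : is_ideal (D b) by apply: is_ideal_colon.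
(* The size of [D b] is measured by the labels it meets; this is at most [#|T|], so a maximum
   exists. *)
pose m b := #|[set t | `[< exists2 x, D b x & cls x = t >]]%SET|.
have [b0 [nCb0 max_b]] : exists b, ~ C b /\ forall c, ~ C c -> (m c <= m b)%N.
  have exP : exists n, `[< exists2 b, ~ C b & m b = n >].
    by exists (m 1); apply/asboolP; exists 1.
  have ubP n : `[< exists2 b, ~ C b & m b = n >] -> (n <= #|T|)%N.
    by case/asboolP=> b _ <-; apply: max_card.
  case: (ex_maxnP exP ubP) => n /asboolP[b nCb <-] maxn; exists b; split=> // c nCc.
  by apply: maxn; apply/asboolP; exists c.
exists b0 => //; apply/prime_idealP; split=> [||u v Cuvb]; first exact: idD.
  by rewrite /= mul1r.
have [Cvb|nCvb] := pselect (D b0 v); [by right|left].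
have sD : D b0 `<=` D (v * b0).
  by move=> x; rewrite /D /= mulrCA; case: idC => _ _; apply.
(* As v b0 is outside C, maximality forces equal label sets. Hence u, which lies in [D (v * b0)], is
   congruent modulo p to an element of [D b0], an ideal containing p. *)
have eq_cls : [set t | `[< exists2 x, D (v * b0) x & cls x = t >]]%SET =
              [set t | `[< exists2 x, D b0 x & cls x = t >]]%SET.
  apply/esym/eqP; rewrite eqEcard; apply/andP; split; last exact: max_b.
  apply/fintype.subsetP => t; rewrite !inE => -[x /sD Dx xt].
  by exists x.
have : cls u \in [set t | `[< exists2 x, D (v * b0) x & cls x = t >]]%SET.
  by rewrite !inE; exists u; rewrite /D //= mulrA.
rewrite eq_cls !inE => -[x Dx /esym/cls_eq pux].
apply: is_idealBr (idD b0) _ Dx.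
apply: principal_sub pux; first exact: idD.
exact: is_idealMr.
Qed.

Lemma exists_prime_above C : is_ideal C -> C p%:R -> ~ C 1 ->
  exists2 Q, prime_ideal Q & C `<=` Q.
Proof.
move=> idC Cp C1; have [b _ prb] := prime_transporter idC Cp C1.
by exists [set x | C (x * b)] => // x Cx; apply: is_idealMr.
Qed.

(** * Conjugate primes, their inverses, and the factorization of p *)

Section Conjugation.
Variables (G : finType) (s : G -> {rmorphism A -> A}).
Hypothesis p_prime : prime p.
Hypothesis norm_int : forall x, exists m : int, \prod_g s g x = m%:~R.
Hypothesis norm_dvd : forall x, exists z, \prod_g s g x = x * z.

(** Otherwise a Bezout relation between p and m would put 1 in Q. *)
Lemma prime_above_int Q (m : int) : prime_ideal Q -> Q p%:R -> Q m%:~R ->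
  (p %| m)%Z.
Proof.
move=> /prime_idealP[idQ Q1 _] Qp Qm; apply: contrapT => npm; apply: Q1.
have : coprimez p m by rewrite coprimezE coprime_sym coprime_sym prime_coprime //; apply/negP.
case/coprimezP=> -[u v] /= uv1; rewrite -[1]/(1%:~R) -uv1 intrD !intrM.
case: (idQ) => _ QD QM; apply: QD; exact: QM.
Qed.

(* If no conjugate of Q lies in Q', pick w = -1 mod all conjugates of Q and
   w in Q': its norm is a rational integer that is in Q' but is a unit mod Q. *)
Lemma primes_above_conjugate Q Q' :
  prime_ideal Q -> Q p%:R -> prime_ideal Q' -> Q' p%:R ->
  exists g, [set x | Q (s g x)] = Q'.
Proof.
move=> prQ Qp prQ' Q'p; have [idQ Q1 _] := (prime_idealP Q).1 prQ.
have idQ' := prime_is_ideal prQ'.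
have [[g sg]|noconj] := pselect (exists g, [set x | Q (s g x)] `<=` Q').
  exists g; apply: prime_above_eq sg; rewrite /= ?rmorph_nat //.
  exact: prime_preim.
have /choice[y sy] g : exists y, Q (s g y) /\ ~ Q' y.
  apply: contrapT => nex; apply: noconj; exists g => x Qx.
  by apply: contrapT => nQ'x; apply: nex; exists x.
have nQ'y : ~ Q' (\prod_g y g) by apply: prime_prod => // g _; case: (sy g).
have [z Q'yz] := prime_above_maximal prQ' Q'p nQ'y.
set w := _ - 1 in Q'yz.
have [m Nm] := norm_int w.
have Q'm : Q' m%:~R.
  by rewrite -Nm; have [c ->] := norm_dvd w; apply: is_idealMr.
have Qm : Q m%:~R.
  have /dvdzP[k ->] := prime_above_int prQ' Q'p Q'm.
  by rewrite intrM; case: idQ => _ _; apply.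
have : ~ Q (\prod_g s g w).
  apply: prime_prod => // g _ Qw; apply: Q1.
  rewrite -(subKr (s g (\prod_g y g * z)) 1) -[X in _ - (_ - X)](rmorph1 (s g)) -rmorphB.
  apply: is_idealB Qw => //; rewrite rmorphM (bigD1 g) //= rmorphM -mulrA.
  by apply: is_idealMr => //; case: (sy g).
by rewrite Nm.
Qed.

Hypothesis s_surj : forall g y, exists x, s g x = y.
Hypothesis s_dvd : forall g x, pA (s g x) -> pA x.

(** Some prime has the form (pA : b), and Q is its preimage under some [s g]; the required
    multiplier is a preimage of b under the same [s g]. *)
Lemma prime_above_transporter Q : prime_ideal Q -> Q p%:R ->
  exists2 b, ~ pA b & forall x, Q x -> pA (x * b).
Proof.
move=> prQ Qp; have [idQ Q1 _] := (prime_idealP Q).1 prQ.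
have [|b npb prb] := prime_transporter (is_ideal_principal p%:R) (principal_refl p%:R).
  by move=> /(principal_sub idQ Qp).
have := primes_above_conjugate prb _ prQ Qp; rewrite /=.
case=> [|g sgQ]; first by exists b.
have [c sc] := s_surj g b; exists c => [|x].
  apply: contra_not npb => -[z cz]; rewrite -sc cz rmorphM rmorph_nat.
  by exists (s g z).
by rewrite -{1}sgQ /= -sc -rmorphM; apply: s_dvd.
Qed.

Local Notation pi := (p%:R : A).
Hypothesis p_reg : GRing.lreg pi.
(** Complete integral closedness for fractions b / p: if p is a common denominator of all their
    powers, they lie in the ring. *)
Hypothesis p_closed : forall b, (forall k, exists z, pi * b ^+ k = pi ^+ k * z) -> pA b.

Lemma p_exp_reg k : GRing.lreg (pi ^+ k).
Proof. exact: lregX. Qed.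

(** Invertibility as a fractional ideal, with inverse J / p^k; powers of p are the only
    denominators, which avoids a fraction field. *)
Definition invertible I : Prop :=
  exists k J, is_ideal J /\ ideal_mul I J = principal_ideal (pi ^+ k).

Lemma invertible_setT : invertible setT.
Proof.
exists 0, setT; split; first exact: is_ideal_setT.
rewrite expr0; apply/seteqP; split=> x _; first by exists x; rewrite mul1r.
by rewrite -[x]mulr1; apply: mem_ideal_mul.
Qed.

Lemma invertible_mul I I' : is_ideal I -> is_ideal I' ->
  invertible I -> invertible I' -> invertible (ideal_mul I I').
Proof.
move=> idI idI' [k [J [idJ IJ]]] [k' [J' [idJ' IJ']]].
exists (k + k')%N, (ideal_mul J J'); split; first exact: is_ideal_mul.
by rewrite ideal_mulACA // IJ IJ' ideal_mul_principal exprD.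
Qed.

Lemma invertible_exp I n : is_ideal I -> invertible I -> invertible (ideal_exp I n).
Proof.
move=> idI invI; elim: n => [|n IHn]; first exact: invertible_setT.
by rewrite ideal_expS; apply: invertible_mul => //; apply: is_ideal_exp.
Qed.

Lemma invertible_prod g (F : 'I_g -> set A) :
  (forall i, is_ideal (F i)) -> (forall i, invertible (F i)) ->
  invertible (\big[@ideal_mul A/setT]_(i < g) F i).
Proof.
move=> idF invF.
suff [] : is_ideal (\big[@ideal_mul A/setT]_(i < g) F i) /\
  invertible (\big[@ideal_mul A/setT]_(i < g) F i) by [].
elim/big_rec: _ => [|i I _ [idI invI]].
  by split; [exact: is_ideal_setT|exact: invertible_setT].
by split; [exact: is_ideal_mul|exact: invertible_mul].
Qed.

(** Multiplying x I, included in I L, by J gives p^k x in p^k L, and p^k is regular. *)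
Lemma invertible_cancel I L x : invertible I -> is_ideal L ->
  (forall y, I y -> ideal_mul I L (y * x)) -> L x.
Proof.
move=> [k [J [idJ IJ]]] idL ILx.
have ILJ w j : ideal_mul I L w -> J j -> exists2 l, L l & pi ^+ k * l = w * j.
  move=> ILw Jj; have idS := is_ideal_colon j (is_ideal_scale (pi ^+ k) idL).
  apply: (ideal_mul_sub idS) ILw => y l Iy Ll /=.
  have [z yj] : principal_ideal (pi ^+ k) (y * j) by rewrite -IJ; apply: mem_ideal_mul.
  by exists (z * l); [case: idL => _ _; apply|rewrite mulrA -yj mulrAC].
have : ideal_mul I J (pi ^+ k) by rewrite IJ; apply: principal_refl.
have idS := is_ideal_colon x (is_ideal_scale (pi ^+ k) idL).
move/(ideal_mul_sub idS) => /(_ _)[y j Iy Jj|l Ll /p_exp_reg <-//].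
by rewrite /= mulrAC; case: (ILJ _ _ (ILx y Iy) Jj) => l Ll ?; exists l.
Qed.

(** To contain is to divide. Write p^k as a sum of a_i j_i with a_i in I and j_i in J; since p is in
    I, each p j_i equals p^k c_i, and p is the sum of the a_i c_i. *)
Lemma invertible_div I : invertible I -> I pi ->
  ideal_mul I [set c | forall y, I y -> pA (c * y)] pi.
Proof.
move=> [k [J [idJ IJ]]] Ip.
have [n [a [j [Ia Jj eq_p]]]] : ideal_mul I J (pi ^+ k).
  by rewrite IJ; apply: principal_refl.
have /choice[c cj] : forall i, exists c, pi * j i = pi ^+ k * c.
  move=> i; have : ideal_mul I J (pi * j i) by apply: mem_ideal_mul.
  by rewrite IJ => -[z ?]; exists z.
exists n, a, c; split=> // [i y Iy|].
- have [z zy] : principal_ideal (pi ^+ k) (y * j i) by rewrite -IJ; apply: mem_ideal_mul.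
  exists z; apply: (p_exp_reg (k := k)).
  by rewrite mulrA -cj -mulrA [j i * y]mulrC zy mulrCA.
- apply: (p_exp_reg (k := k)); rewrite {1}eq_p mulr_suml mulr_sumr.
  by apply: eq_bigr => i _; rewrite mulrCA -cj mulrA mulrAC -mulrA.
Qed.

(* With Q J = p M, either M is the unit ideal or M = Q; the latter makes
   multiplication by b / p stabilise Q. *)
Lemma prime_above_invertible Q : prime_ideal Q -> Q pi -> invertible Q.
Proof.
move=> prQ Qp; have idQ := prime_is_ideal prQ.
have [b npb Qb] := prime_above_transporter prQ Qp.
pose J := [set y | forall x, Q x -> pA (y * x)].
have idJ : is_ideal J by apply/is_ideal_transporter/is_ideal_principal.
exists 1, J; split=> //; rewrite expr1; apply/seteqP; split.
  apply: ideal_mul_sub => [|x y Qx Jy]; first exact: is_ideal_principal.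
  by rewrite mulrC; apply: Jy.
have idQJ : is_ideal (ideal_mul Q J) by apply: is_ideal_mul.
apply: principal_sub => //; apply: contrapT => nQJp.
pose M := [set m | ideal_mul Q J (m * pi)].
have idM : is_ideal M by apply: is_ideal_colon.
have Jp : J pi by move=> x _; exists x.
have sQM : Q `<=` M by move=> x Qx; apply: mem_ideal_mul.
have sMQ : M `<=` Q.
  move=> m Mm; apply: contrapT => nQm.
  have [z /sQM Mz] := prime_above_maximal prQ Qp nQm; apply: nQJp.
  have : M 1 by rewrite -(subKr (m * z) 1); apply: is_idealB => //; apply: is_idealMr.
  by rewrite /M /= mul1r.
apply/npb/p_closed => k.
(* Keeping x in Q lets the induction continue: it starts at x = p, and multiplication by b / p stays
   in Q. *)
suff [x Qx ->] : exists2 x, Q x & pi * b ^+ k = pi ^+ k * x by exists x.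
elim: k => [|k [x Qx IHk]]; first by exists pi => //; rewrite mulrC.
have [y xb] := Qb _ Qx.
exists y; last by rewrite exprSr mulrA IHk -mulrA xb mulrA -exprSr.
apply: sMQ; rewrite /M /= mulrC -xb; apply: mem_ideal_mul => // z Qz.
by rewrite mulrC; apply: Qb.
Qed.

(** From b Q inside pA follows b^k Q^k inside p^k A; with p in every Q^k, [p_closed] would put b in
    pA. *)
Lemma prime_above_exp_notin Q : prime_ideal Q -> Q pi -> exists k, ~ ideal_exp Q k pi.
Proof.
move=> prQ Qp; apply: contrapT => allk.
have [b npb Qb] := prime_above_transporter prQ Qp.
apply/npb/p_closed => k; rewrite mulrC.
suff sub x : ideal_exp Q k x -> exists z, b ^+ k * x = pi ^+ k * z.
  by apply: sub; apply: contrapT => nQk; apply: allk; exists k.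
elim: k x => [|k IHk] x; first by exists x.
rewrite ideal_expS => Qx; rewrite mulrC.
have idS := is_ideal_colon (b ^+ k.+1) (is_ideal_principal (pi ^+ k.+1)).
apply: (ideal_mul_sub idS) Qx => y w /Qb[z yb] /IHk[v wb] /=.
by exists (z * v); rewrite !exprS mulrACA yb [w * _]mulrC wb mulrACA.
Qed.

Lemma prime_above_valuation Q : prime_ideal Q -> Q pi ->
  exists2 e, (0 < e)%N & forall n, ideal_exp Q n pi <-> (n <= e)%N.
Proof.
move=> prQ Qp; have idQ := prime_is_ideal prQ.
have exk : exists k, `[< ~ ideal_exp Q k pi >].
  by have [k nk] := prime_above_exp_notin prQ Qp; exists k; apply/asboolP.
(* The least k with p outside Q^k is at least 2, since Q^0 is the whole ring and p is in Q; the
   valuation is k - 1. *)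
case: (ex_minnP exk) => -[|[|e]] /asboolP nQ min_e; first by case: nQ.
  by case: nQ; rewrite -[pi]expr1; apply: mem_ideal_exp.
exists e.+1 => // n; split=> [Qn|le_ne].
  by rewrite leqNgt; apply/negP => lt_en; apply/nQ/(ideal_exp_sub idQ lt_en).
apply: contrapT => nQn; have := min_e n (introT (asboolP _) nQn).
by rewrite leqNgt ltnS le_ne.
Qed.

(** Conjugation fixes p and carries powers of one prime into powers of another, in both directions.
    If no prime lies above p, the choice of 0 is vacuous. *)
Lemma primes_above_same_valuation :
  exists e, forall Q, prime_ideal Q -> Q pi ->
    (0 < e)%N /\ forall n, ideal_exp Q n pi <-> (n <= e)%N.
Proof.
have [[Q [prQ Qp]]|noQ] := pselect (exists Q, prime_ideal Q /\ Q pi); last first.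
  by exists 0%N => Q prQ Qp; case: noQ; exists Q.
have [e e_gt0 Qe] := prime_above_valuation prQ Qp; exists e => Q' prQ' Q'p.
split=> // n; rewrite -Qe.
have sub P P' : prime_ideal P -> P pi -> prime_ideal P' -> P' pi ->
    ideal_exp P n pi -> ideal_exp P' n pi.
  move=> prP Pp prP' P'p; have [g sg] := primes_above_conjugate prP' P'p prP Pp.
  rewrite -{2}(rmorph_nat (s g)); apply: rmorph_ideal_exp.
    exact: prime_is_ideal.
  by rewrite -sg.
by split; apply: sub.
Qed.

Lemma primes_above_finite : exists g (P : 'I_g -> set A),
  injective P /\ forall Q, (prime_ideal Q /\ Q pi) <-> exists i, P i = Q.
Proof.
have [[Q [prQ Qp]]|noQ] := pselect (exists Q, prime_ideal Q /\ Q pi); last first.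
  exists 0, (fun=> setT); split=> [[]//|Q]; split=> [prQ|[[]]//].
  by case: noQ; exists Q.
(* All primes above p are conjugates of Q; several g may give the same one. *)
pose r := undup [seq [set x | Q (s g x)] | g <- enum G].
exists (size r), (fun i => nth setT r i); split=> [i j /eqP|Q'].
  by rewrite nth_uniq ?undup_uniq // => /eqP/val_inj.
split=> [[prQ' Q'p]|[i <-]].
  have [g sg] := primes_above_conjugate prQ Qp prQ' Q'p.
  have Q'r : Q' \in r by rewrite mem_undup; apply/mapP; exists g; rewrite ?mem_enum.
  by exists (Ordinal (etrans (index_mem _ _) Q'r)); rewrite nth_index.
have : nth setT r i \in r by rewrite mem_nth.
rewrite mem_undup => /mapP[g _ ->]; split; first exact: prime_preim.
by rewrite /= rmorph_nat.
Qed.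

(** Chinese remainders: powers of distinct maximal ideals are comaximal, so their intersection is
    their product. *)
Lemma primes_above_prod_exp g (P : 'I_g -> set A) e x :
  injective P -> (forall i, prime_ideal (P i)) -> (forall i, P i pi) ->
  (forall i, ideal_exp (P i) e x) ->
  (\big[@ideal_mul A/setT]_(i < g) ideal_exp (P i) e) x.
Proof.
elim: g P => [|g IHg] P injP prP Pp Pex; first by rewrite big_ord0.
rewrite big_ord_recl; set P0 := P ord0.
pose P' i := P (lift ord0 i).
have prP0 : prime_ideal P0 by apply: prP.
have idP0 := prime_is_ideal prP0.
have P'x : (\big[@ideal_mul A/setT]_(i < g) ideal_exp (P' i) e) x.
  apply: IHg => [i j /injP/lift_inj//|i|i|i]; [exact: prP|exact: Pp|exact: Pex].
set R := bigop _ _ _ in P'x *.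
have idR : is_ideal R.
  by apply: is_ideal_prod => i; apply: is_ideal_exp; apply: prime_is_ideal; apply: prP.
have /choice[y Py] i : exists y, P' i y /\ ~ P0 y.
  apply: contrapT => noy; have /(prime_above_eq (prP _) (Pp _) prP0)/injP : P' i `<=` P0.
    by move=> y Py; apply: contrapT => nP0y; apply: noy; exists y.
  by move/eqP; rewrite eq_sym (negPf (neq_lift _ _)).
have Ry : R (\prod_i (y i) ^+ e).
  by apply: mem_ideal_prod => i; apply: mem_ideal_exp; case: (Py i).
have nP0y : ~ P0 (\prod_i (y i) ^+ e).
  by apply: prime_prod => // i _ /(prime_exp prP0); case: (Py i).
have [z P0yz] := prime_above_maximal prP0 (Pp _) nP0y.
set w := _ * z in P0yz.
have Rw : R w by apply: is_idealMr.
have R1 : R (1 - (1 - w) ^+ e).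
  rewrite -opprB subrX1 -mulNr opprB subKr; exact: is_idealMr.
have P0e : ideal_exp P0 e ((1 - w) ^+ e).
  by apply: mem_ideal_exp; rewrite -opprB; apply: is_idealN.
(* Here x lies in both P0^e and R, while the two coefficients, of sum 1, lie in R and in P0^e; each
   term is thus in P0^e R. *)
have -> : x = x * (1 - (1 - w) ^+ e) + (1 - w) ^+ e * x by ring.
have [_ LD _] : is_ideal (ideal_mul (ideal_exp P0 e) R).
  by apply: is_ideal_mul; apply: is_ideal_exp.
by apply: LD; apply: mem_ideal_mul => //; apply: Pex.
Qed.

Lemma prime_above_factorization : exists g e (P : 'I_g -> set A),
  prime_factorization pA P (fun=> e).
Proof.
have [g [P [injP allP]]] := primes_above_finite.
have [e eP] := primes_above_same_valuation.
have prP i : prime_ideal (P i) by case: (allP (P i)) => _ [|//]; exists i.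
have Pp i : P i pi by case: (allP (P i)) => _ [|//]; exists i.
have idP i := prime_is_ideal (prP i).
exists g, e, P; split=> // [i|]; first by case: (eP _ (prP i) (Pp i)).
set B := bigop _ _ _.
have idB : is_ideal B by apply: is_ideal_prod => i; apply: is_ideal_exp.
have Bp : B pi.
  apply: primes_above_prod_exp => // i.
  by case: (eP _ (prP i) (Pp i)) => _ ->.
have invB : invertible B.
  apply: invertible_prod => i; first exact: is_ideal_exp.
  by apply: invertible_exp => //; apply: prime_above_invertible.
apply/seteqP; split; first exact: principal_sub.
(* [C] plays the role of p B^-1, and 1 in C means that B is inside pA. Otherwise C lies in some P_i,
   and p, being in B C, would lie in P_i^(e+1). *)
have := invertible_div invB Bp; set C := [set _ | _] => BCp.
have idC : is_ideal C by apply: is_ideal_transporter; apply: is_ideal_principal.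
have [C1|nC1] := pselect (C 1); first by move=> y /C1; rewrite mul1r.
have Cp : C pi by move=> y _; exists y.
have [Q prQ sCQ] := exists_prime_above idC Cp nC1.
have [i eqQ] : exists i, P i = Q by apply/allP; split=> //; apply: sCQ.
rewrite -eqQ in sCQ.
have : ideal_exp (P i) e.+1 pi.
  rewrite ideal_expS ideal_mulC; apply: ideal_mulSl (ideal_mulSr sCQ BCp).
  by apply: (ideal_prod_sub (F := fun i => ideal_exp (P i) e)) => j; apply: is_ideal_exp.
by case: (eP _ (prP i) (Pp i)) => _ -> ; rewrite ltnn.
Qed.

(** * Uniqueness of the factorization of p *)

Section Factorization.
Variables (g : nat) (P : 'I_g -> set A) (e : 'I_g -> nat).
Hypothesis facP : prime_factorization pA P e.

Lemma factorization_prime i : prime_ideal (P i).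
Proof. by case: facP. Qed.
Hint Resolve factorization_prime : core.

Lemma factorization_exp_above i : ideal_exp (P i) (e i) pi.
Proof.
case: facP => _ _ _ eqpA.
have : pA pi by apply: principal_refl.
rewrite eqpA; apply: (ideal_prod_sub (F := fun i => ideal_exp (P i) (e i))) => j.
by apply: is_ideal_exp; apply: prime_is_ideal.
Qed.

Lemma factorization_above i : P i pi.
Proof.
case: facP => _ _ e_gt0 _.
by apply: (ideal_exp_sub1 _ (e_gt0 i)) (factorization_exp_above i); apply: prime_is_ideal.
Qed.

Lemma factorization_prod_mem (y : 'I_g -> A) :
  (forall i, ideal_exp (P i) (e i) (y i)) -> pA (\prod_i y i).
Proof. by case: facP => _ _ _ -> ?; apply: mem_ideal_prod. Qed.

(** Were Q missing, each P_i would have an element outside Q by maximality; the product of suitable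
    powers of these is in pA, hence in Q, against primality. *)
Lemma factorization_complete Q : prime_ideal Q -> Q pi -> exists i, P i = Q.
Proof.
move=> prQ Qp; apply: contrapT => noi.
have /choice[y Py] i : exists y, P i y /\ ~ Q y.
  apply: contrapT => noy; apply: noi; exists i.
  apply: prime_above_eq (factorization_above i) prQ _ => // y Py.
  by apply: contrapT => nQy; apply: noy; exists y.
have : pA (\prod_i (y i) ^+ e i).
  by apply: factorization_prod_mem => i; apply: mem_ideal_exp; case: (Py i).
move/(principal_sub (prime_is_ideal prQ) Qp).
by apply: prime_prod => // i _ /(prime_exp prQ); case: (Py i).
Qed.

(* Cancelling P_i^(e_i) from pA = P_i^(e_i).R, included in P_i^(e_i + 1),
   would put R in P_i. *)
Lemma factorization_exp_sharp i : ~ ideal_exp (P i) (e i).+1 pi.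
Proof.
move=> Pi1; have idPi := prime_is_ideal (factorization_prime i).
have /choice[y Py] j : exists y, j != i -> P j y /\ ~ P i y.
  (* At j = i nothing is required, and 0 is a filler. *)
  have [->|neq_ji] := eqVneq j i; first by exists 0.
  apply: contrapT => noy; case: facP => _ injP _ _; case/eqP: neq_ji; apply: injP.
  apply: prime_above_eq (factorization_above j) _ _ => // y Py.
  by apply: contrapT => nPy; apply: noy; exists y.
pose x := \prod_(j | j != i) y j ^+ e j.
have : ~ P i x.
  by apply: prime_prod => // j /Py[_ nPy] /(prime_exp (factorization_prime i)).
apply; apply: (invertible_cancel (I := ideal_exp (P i) (e i))) => // [|q Pq].
  by apply: invertible_exp => //; apply: prime_above_invertible (factorization_above i).
rewrite ideal_mulC -ideal_expS.
suff : pA (q * x) by apply: principal_sub Pi1 _; apply: is_ideal_exp.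
pose z j := if j == i then q else y j ^+ e j.
have -> : q * x = \prod_j z j.
  rewrite (bigD1 i) //= /z eqxx; congr (_ * _).
  by apply: eq_bigr => j /negPf ->.
apply: factorization_prod_mem => j; rewrite /z; case: eqVneq => [->//|neq_ji].
by apply: mem_ideal_exp; case: (Py j neq_ji).
Qed.

End Factorization.

(** Both families enumerate the primes above p, and each exponent is the largest n with p in the
    n-th power of its prime. *)
Lemma prime_above_factorization_unique g e (P : 'I_g -> set A) g' (P' : 'I_g' -> set A) e' :
  prime_factorization pA P (fun=> e) -> prime_factorization pA P' e' ->
  g' = g /\ forall i, e' i = e.
Proof.
move=> facP facP'; split=> [|i].
  have le_g h h' (R : 'I_h -> set A) (R' : 'I_h' -> set A) d d' :
      prime_factorization pA R d -> prime_factorization pA R' d' -> (h <= h')%N.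
    move=> facR facR'.
    have /choice[f fR] i : exists j, R' j = R i.
      apply: (factorization_complete facR').
        exact: (factorization_prime facR).
      exact: (factorization_above facR).
    have : injective f.
      by case: facR => _ injR _ _ i j eq_f; apply: injR; rewrite -!fR eq_f.
    by move/leq_card; rewrite !card_ord.
  by apply/eqP; rewrite eqn_leq (le_g _ _ _ _ _ _ facP facP') (le_g _ _ _ _ _ _ facP' facP).
have prP'i := factorization_prime facP' i.
have [j eqPj] := factorization_complete facP prP'i (factorization_above facP' i).
have idP'i := prime_is_ideal prP'i.
have ltF m n : ideal_exp (P' i) m pi -> ~ ideal_exp (P' i) n.+1 pi -> (m <= n)%N.
  move=> Pm Pn; rewrite leqNgt; apply/negP => lt_nm; apply: Pn.
  exact: (ideal_exp_sub idP'i lt_nm).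
apply/eqP; rewrite eqn_leq; apply/andP; split; apply: ltF.
- exact: (factorization_exp_above facP').
- by rewrite -eqPj; apply: (factorization_exp_sharp facP).
- by rewrite -eqPj; apply: (factorization_exp_above facP j).
- exact: (factorization_exp_sharp facP').
Qed.

End Conjugation.
End FiniteResidueRing.

HB.instance Definition _ (K : fieldExtType rat) :=
  GRing.RMorphism.copy (@integer_val K) (\val : ring_of_integers K -> K).

(** * Rational integers in O_K and finiteness of O_K modulo p *)

Section RationalIntegers.
Variable K : fieldExtType rat.
Local Notation OK := (ring_of_integers K).
Local Notation val := (@integer_val K).

(** The integral equation is transported to [algC], where rational algebraic integers are known to
    be integers. *)
Lemma rational_algebraic_integer (r : rat) :
  r%:A \in algebraic_integers K -> exists m : int, r = m%:~R.
Proof.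
case/asboolP=> q q_mon qr0; exists (numq r); apply/esym/numqK.
have {qr0} q0 : root (map_poly (intr : int -> rat) q) r.
  rewrite -(fmorph_root (in_alg K)) -map_poly_comp /=.
  by rewrite (eq_map_poly (g := intr)) // => m; apply: (rmorph_int (in_alg K)).
rewrite -Cint_rat; apply: Cint_rat_Aint; first exact: Crat_rat.
apply: (root_monic_Aint (p := map_poly intr q)).
- rewrite -(fmorph_root (ratr : {rmorphism rat -> algC})) -map_poly_comp /= in q0.
  by rewrite (eq_map_poly (g := intr)) // in q0 => m /=; rewrite ratr_int.
- exact: monic_map.
- by apply/polyOverP => i; rewrite coef_map /= intr_int.
Qed.

Lemma integers_natr_neq0 p : (0 < p)%N -> p%:R != 0 :> K.
Proof.
move=> p_gt0; rewrite -(rmorph_nat (in_alg K)) fmorph_eq0.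
by rewrite pnatr_eq0 -lt0n.
Qed.

Lemma integers_natr_reg p : (0 < p)%N -> GRing.lreg (p%:R : OK).
Proof.
move=> p_gt0 x y /(congr1 val); rewrite !rmorphM rmorph_nat.
by move/(mulfI (integers_natr_neq0 p_gt0)) => eq_xy; apply: val_inj.
Qed.

Lemma primitive_relation (V : vectType rat) p k (x : 'I_k -> V) :
  (1 < p)%N -> (\dim {:V} < k)%N ->
  exists c : 'I_k -> int, \sum_i (c i)%:~R *: x i = 0 /\ exists i, ~~ (p %| c i)%Z.
Proof.
move=> p_gt1 lt_k; have : ~~ free [tuple x i | i < k].
  apply: contraL lt_k => /eqP; rewrite size_tuple -leqNgt => <-; exact/dimvS/subvf.
move/freeP=> nfree.
have [c [cx0 [i0 ci0]]] : exists c : 'I_k -> rat,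
    \sum_i c i *: x i = 0 /\ exists i, c i != 0.
  apply: contrapT => noc; apply: nfree => c cx0 i; apply/eqP/negP => /negP ci.
  apply: noc; exists c; split; last by exists i.
  by rewrite -[RHS]cx0; apply: eq_bigr => j _; rewrite nth_mktuple.
(* The coefficients are read as a polynomial in order to clear denominators and divide by the
   content; p cannot divide every coefficient of a primitive polynomial. *)
have [q [a a_neq0 def_c]] := rat_poly_scale (rVpoly (\row_i c i)).
pose u : rat := a%:~R^-1 * (zcontents q)%:~R.
have coefE j : (rVpoly (\row_i c i))`_j = u * ((zprimitive q)`_j)%:~R.
  by rewrite def_c coefZ coef_map /= {1}[q]zpolyEprim coefZ rmorphM mulrA.
have cE i : c i = u * ((zprimitive q)`_i)%:~R.
  by rewrite -coefE coef_rVpoly_ord mxE.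
have u_neq0 : u != 0 by apply: contraNneq ci0 => u0; rewrite cE u0 mul0r.
have q_neq0 : q != 0.
  by apply: contraNneq ci0 => q0; rewrite cE q0 zprimitive0 coef0 mulr0.
exists (fun i => (zprimitive q)`_i); split.
  apply/eqP; rewrite -(inj_eq (scalerI u_neq0)) scaler0 scaler_sumr -[X in _ == X]cx0.
  by apply/eqP/eq_bigr => i _; rewrite scalerA cE.
apply/not_existsP => allp.
have : (p %| zcontents (zprimitive q))%Z.
  rewrite dvdz_contents; apply/polyOverP => j.
  have [lt_jk|le_kj] := ltnP j k; first by apply/negPn/negP/(allp (Ordinal lt_jk)).
  have /eqP := coefE j; rewrite coef_rVpoly insubF; last by rewrite ltnNge le_kj.
  by rewrite eq_sym mulf_eq0 (negPf u_neq0) intr_eq0 => /eqP ->; rewrite dvdz0.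
by rewrite zcontents_primitive q_neq0 dvdz1 /= => /eqP p1; rewrite p1 in p_gt1.
Qed.

(** For p prime, this is linear independence over F_p of the classes in O_K / p, without forming the
    quotient. *)
Definition independent_mod p k (x : 'I_k -> OK) :=
  forall c : 'I_k -> int, principal_ideal p%:R (\sum_i (c i)%:~R * x i) ->
  forall i, (p %| c i)%Z.

Lemma independent_mod_bound p k (x : 'I_k -> OK) :
  (1 < p)%N -> independent_mod p x -> (k <= \dim {:K})%N.
Proof.
move=> p_gt1 indx; rewrite leqNgt; apply/negP => lt_k.
have [c [cx0 [i /negP npci]]] := primitive_relation (fun i => val (x i)) p_gt1 lt_k.
apply/npci/indx; exists 0; rewrite mulr0; apply: val_inj.
rewrite rmorph_sum rmorph0 -[RHS]cx0; apply: eq_bigr => j _.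
rewrite rmorphM rmorph_int -[RHS]mulr_algl; congr (_ * _).
exact/esym/(rmorph_int (in_alg K)).
Qed.

(** The degree of K bounds the length of a family independent modulo p. A longest one spans O_K
    modulo p, so finitely many coefficient vectors suffice, and no integral basis is involved. *)
Lemma integers_residues_finite p : prime p ->
  exists (T : finType) (cls : OK -> T),
    forall x y, cls x = cls y -> principal_ideal p%:R (x - y).
Proof.
move=> p_prime; have p_gt1 := prime_gt1 p_prime.
have idp := is_ideal_principal (p%:R : OK).
have exk : exists k, `[< exists x : 'I_k -> OK, independent_mod p x >].
  by exists 0; apply/asboolP; exists (fun=> 0) => c _ [].
have ubk k : `[< exists x : 'I_k -> OK, independent_mod p x >] -> (k <= \dim {:K})%N.
  by case/asboolP=> x; apply: independent_mod_bound.
case: (ex_maxnP exk ubk) => k /asboolP[x indx] maxk.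
have span (y : OK) : exists c : 'I_k -> int, principal_ideal p%:R (y - \sum_i (c i)%:~R * x i).
  (* By maximality, the family extended by y has a nontrivial relation modulo p. The coefficient of
     y is prime to p, and a Bezout relation solves for y. *)
  pose yx (i : 'I_k.+1) := if unlift ord0 i is Some j then x j else y.
  have [c [pc [i npci]]] : exists c : 'I_k.+1 -> int,
      principal_ideal p%:R (\sum_i (c i)%:~R * yx i) /\ exists i, ~ (p %| c i)%Z.
    apply: contrapT => noc; suff : (k.+1 <= k)%N by rewrite ltnn.
    apply: maxk; apply/asboolP; exists yx => c pc i; apply: contrapT => npci.
    by apply: noc; exists c; split=> //; exists i.
  have {}pc : principal_ideal p%:R
      ((c ord0)%:~R * y + \sum_j (c (lift ord0 j))%:~R * x j).
    move: pc; rewrite big_ord_recl /yx unlift_none; congr (principal_ideal _ (_ + _)).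
    by apply: eq_bigr => j _; rewrite liftK.
  have npc0 : ~ (p %| c ord0)%Z.
    move=> pc0; apply: npci; case: (unliftP ord0 i) => [j|] -> //.
    apply: (indx (fun j => c (lift ord0 j))).
    case/dvdzP: pc0 => m c0; rewrite -[X in principal_ideal _ X](addKr ((c ord0)%:~R * y)).
    rewrite addrC; apply: is_idealB => //.
    by exists (m%:~R * y); rewrite c0 intrM -mulrA mulrCA.
  have : coprimez p (c ord0) by rewrite coprimezE prime_coprime //; apply/negP.
  case/coprimezP=> -[u v] /= uv1; exists (fun j => - v * c (lift ord0 j)).
  have -> : y - \sum_i (- v * c (lift ord0 i))%:~R * x i =
      v%:~R * ((c ord0)%:~R * y + \sum_i (c (lift ord0 i))%:~R * x i) + p%:R * (u%:~R * y).
    have -> : \sum_i (- v * c (lift ord0 i))%:~R * x i =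
        - (v%:~R * \sum_i (c (lift ord0 i))%:~R * x i).
      by rewrite mulr_sumr -sumrN; apply: eq_bigr => j _; rewrite intrM mulrNz !mulNr mulrA.
    have uv1R : u%:~R * p%:R + v%:~R * (c ord0)%:~R = 1 :> OK.
      by rewrite -[p%:R]/(p%:Z%:~R) -!intrM -intrD uv1.
    by rewrite -{1}[y]mul1r -{1}uv1R; ring.
  by case: idp => _ pD pM; apply: pD; [apply: pM|exists (u%:~R * y)].
have /choice[cls clsP] (y : OK) : exists d : {ffun 'I_k -> 'I_p},
    principal_ideal p%:R (y - \sum_i (d i)%:R * x i).
  have [c pc] := span y.
  have /choice[d cd] i : exists d : 'I_p, principal_ideal (p%:R : OK) ((c i)%:~R - d%:R).
    have p_neq0 : p%:Z != 0 by rewrite -lt0n prime_gt0.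
    have lt_p : (`|(c i %% p)%Z| < p)%N.
      by rewrite -ltz_nat gez0_abs ?modz_ge0 // ltz_pmod // ltz_nat prime_gt0.
    exists (Ordinal lt_p), (c i %/ p)%Z%:~R => /=.
    rewrite -[`|_|%:R]/(`|_|%:Z%:~R) gez0_abs ?modz_ge0 //.
    by rewrite {1}(divz_eq (c i) p) intrD addrK intrM mulrC.
  exists [ffun i => d i]; under eq_bigr do rewrite ffunE.
  apply: is_idealBr pc => //.
  rewrite opprB addrC addrA addrNK -sumrB; apply: ideal_sum => // i.
  by rewrite -mulrBl; apply: (is_idealMr (x i) idp (cd i)).
exists {ffun 'I_k -> 'I_p}, cls => y z eq_cls.
have -> : y - z = (y - \sum_i (cls y i)%:R * x i) - (z - \sum_i (cls z i)%:R * x i).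
  by rewrite eq_cls opprB addrA subrK.
exact: is_idealB.
Qed.

End RationalIntegers.

(** * The Galois group acting on O_K *)

Section GaloisAction.
Variable K : splittingFieldType rat.
Local Notation OK := (ring_of_integers K).
Local Notation val := (@integer_val K).

Lemma galois_integer_subproof (g : gal_of {: K}) (x : OK) :
  g (val x) \in algebraic_integers K.
Proof.
have /asboolP[q q_mon qx0] := integer_valP x; apply/asboolP; exists q => //.
rewrite -(fmorph_root g) -map_poly_comp in qx0.
rewrite (eq_map_poly (g := intmul (1 : K))) // in qx0.
by move=> m; apply: (rmorph_int g).
Qed.

Definition galois_integer (g : gal_of {: K}) (x : OK) : OK :=
  RingOfIntegers (galois_integer_subproof g x).

Lemma galois_integer_is_zmod_morphism g : zmod_morphism (galois_integer g).
Proof. by move=> x y; apply: val_inj; rewrite /= !rmorphB. Qed.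

Lemma galois_integer_is_monoid_morphism g : monoid_morphism (galois_integer g).
Proof. by split=> [|x y]; apply: val_inj; rewrite /= ?rmorph1 ?rmorphM. Qed.

HB.instance Definition _ g :=
  GRing.isZmodMorphism.Build OK OK (galois_integer g) (galois_integer_is_zmod_morphism g).
HB.instance Definition _ g :=
  GRing.isMonoidMorphism.Build OK OK (galois_integer g) (galois_integer_is_monoid_morphism g).

Lemma galois_integerK g : cancel (galois_integer g^-1%g) (galois_integer g).
Proof.
by move=> x; apply: val_inj; rewrite /= -galM ?memvf // mulVg gal_id.
Qed.

Lemma galois_integerVK g : cancel (galois_integer g) (galois_integer g^-1%g).
Proof. by rewrite -{1}[g]invgK; apply: galois_integerK. Qed.

Lemma galois_integer_norm_dvd x : exists z, \prod_g galois_integer g x = x * z.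
Proof.
rewrite (bigD1 (1%g : gal_of {: K})) //=; eexists; congr (_ * _).
by apply: val_inj; rewrite /= gal_id.
Qed.

(** The norm is rational, as K is Galois, and an algebraic integer. *)
Lemma galois_integer_norm_int x : galois 1%VS {: K}%VS ->
  exists m : int, \prod_g galois_integer g x = m%:~R.
Proof.
move=> galK; set N := bigop _ _ _.
have : val N \in 1%VS.
  have <- : galNorm 1 {: K} (val x) = val N.
    rewrite /galNorm rmorph_prod; apply: eq_bigl => g.
    by rewrite gal_kHom ?sub1v // k1AHom.
  by apply: mem_galNorm => //; apply: memvf.
case/vlineP=> r Nr; have := integer_valP N; rewrite Nr.
case/rational_algebraic_integer=> m rm; exists m; apply: val_inj.
by rewrite -[LHS]/(val N) Nr rm rmorph_int; apply: (rmorph_int (in_alg K)).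
Qed.

(* The powers of b / p have bounded denominators, so by pigeonhole b / p is a
   root of some monic X^j - X^i - a with a integral. *)
Lemma integers_almost_integral p (b : OK) : prime p ->
  (forall k, exists z, p%:R * b ^+ k = p%:R ^+ k * z) -> principal_ideal p%:R b.
Proof.
move=> p_prime /choice[z bz].
have p_neq0 := integers_natr_neq0 K (prime_gt0 p_prime).
have [T [cls cls_eq]] := integers_residues_finite K p_prime.
have [i [j [lt_ij [a zij]]]] := powers_congruent cls_eq z.
pose x : K := val b / p%:R.
(* The z_k are the numerators of the powers of x = b / p over the denominator p; a congruence
   between two of them modulo p makes x^j - x^i integral. *)
have zx k : p%:R * x ^+ k = val (z k).
  apply: (mulfI (expf_neq0 k p_neq0)).
  rewrite expr_div_n mulrCA [X in _ * X]mulrCA mulfV ?expf_neq0 // mulr1.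
  by have /(congr1 val) := bz k; rewrite !rmorphM !rmorphXn !rmorph_nat.
have xij : x ^+ j - x ^+ i = val a.
  apply: (mulfI p_neq0); rewrite mulrBr !zx -rmorphB zij rmorphM.
  by rewrite rmorph_nat.
have int_x : x \in algebraic_integers K.
  pose q : {poly K} := 'X^j - ('X^i + (val a)%:P).
  have q_mon : q \is monic.
    rewrite monicE lead_coefDl ?lead_coefXn // size_polyN size_polyXn.
    apply: leq_ltn_trans (size_polyD _ _) _; rewrite gtn_max size_polyXn ltnS lt_ij.
    by rewrite (leq_ltn_trans (size_polyC_leq1 _)) // ltnS (leq_ltn_trans _ lt_ij).
  apply/asboolP; apply: (integral_root_monic q_mon).
    by rewrite rootE !hornerE -xij opprD addrA subrr.
  have /allP q_int : q \is a polyOver (algebraic_integers K).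
    by rewrite rpredB ?rpredD ?rpredX ?polyOverX ?polyOverC // integer_valP.
  by move=> y /q_int/asboolP.
exists (RingOfIntegers int_x); apply: val_inj.
by rewrite rmorphM rmorph_nat /= mulrC divfK.
Qed.

Lemma galois_factorization p : galois 1%VS {: K}%VS -> prime p ->
  exists g e, (exists P : 'I_g -> set OK,
      prime_factorization (principal_ideal p%:R) P (fun=> e)) /\
    forall g' (P' : 'I_g' -> set OK) e',
      prime_factorization (principal_ideal p%:R) P' e' -> g' = g /\ forall i, e' i = e.
Proof.
move=> galK p_prime.
have [T [cls cls_eq]] := integers_residues_finite K p_prime.
pose s g : {rmorphism OK -> OK} := galois_integer g.
have norm_int x : exists m : int, \prod_g s g x = m%:~R.
  exact: galois_integer_norm_int.
have norm_dvd x : exists z, \prod_g s g x = x * z.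
  exact: galois_integer_norm_dvd.
have s_surj g y : exists x, s g x = y.
  by exists (galois_integer g^-1%g y); apply: galois_integerK.
have s_dvd g x : principal_ideal p%:R (s g x) -> principal_ideal p%:R x.
  move=> [y /(congr1 (galois_integer g^-1%g))].
  rewrite /s galois_integerVK rmorphM rmorph_nat => ->.
  by exists (galois_integer g^-1%g y).
have p_reg := integers_natr_reg (K := K) (prime_gt0 p_prime).
have p_closed b := integers_almost_integral (b := b) p_prime.
have [g [e [P facP]]] :=
  prime_above_factorization cls_eq p_prime norm_int norm_dvd s_surj s_dvd p_reg p_closed.
exists g, e; split=> [|g' P' e' facP']; first by exists P.
exact: (prime_above_factorization_unique cls_eq p_prime norm_int norm_dvd s_surj s_dvd
          p_reg p_closed facP facP').
Qed.

End GaloisAction.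

(** * Vanishing of the divergence *)

Theorem proposition3p7 (R : realType) (K : splittingFieldType rat)
    (galK : galois 1%VS {: K}%VS) (p q : nat) (p_prime : prime p)
    (q_prime : prime q) (p_neq_q : p <> q)
    (omega_eq : omega (principal_ideal (p%:R : ring_of_integers K)) =
                omega (principal_ideal (q%:R : ring_of_integers K))) :
  divergence R (principal_ideal (p%:R : ring_of_integers K))
               (principal_ideal (q%:R : ring_of_integers K)) = [set 0].
Proof.
(* All factorizations share g and e, which forces the values chosen by [xget]. *)
have omegaE I g e : (exists P : 'I_g -> set (ring_of_integers K),
      prime_factorization I P (fun=> e)) ->
    (forall g' (P' : 'I_g' -> set (ring_of_integers K)) e',
      prime_factorization I P' e' -> g' = g /\ forall i, e' i = e) ->
    omega I = g /\ Omega I = (g * e)%N.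
  move=> [P facP] uniqP; split.
    rewrite /omega; case: xgetP => [h -> [P' [e' /uniqP[]]]//|/(_ g)[]].
    by exists P, (fun=> e).
  rewrite /Omega; case: xgetP => [h -> [g' [P' [e' [/uniqP[g'E e'E] ->]]]]|/(_ (g * e)%N)[]].
    by rewrite (eq_bigr (fun=> e)) // sum_nat_const card_ord g'E.
  by exists g, P, (fun=> e); rewrite sum_nat_const card_ord.
have [g [e [exP uniqP]]] := galois_factorization galK p_prime.
have [h [f [exQ uniqQ]]] := galois_factorization galK q_prime.
have [omp Omp] := omegaE _ _ _ exP uniqP; have [omq Omq] := omegaE _ _ _ exQ uniqQ.
have eq_hg : h = g by rewrite -omp -omq omega_eq.
rewrite {}eq_hg in exQ uniqQ omq Omq.
have D0 g' (e' f' : 'I_g' -> nat) : g' = g -> (forall i, e' i = e) -> (forall i, f' i = f) ->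
    (forall i : 'I_g', (0 < e' i)%N) ->
    ln ((g * f)%:R / (g * e)%:R) - (g * e)%:R^-1 *
      \sum_(i < g') (e' i)%:R * ln ((f' i)%:R / (e' i)%:R) = 0 :> R.
  move=> eq_g' e'E f'E e'_gt0.
  rewrite (eq_bigr (fun=> e%:R * ln (f%:R / e%:R))) => [|i _]; last by rewrite e'E f'E.
  rewrite sumr_const card_ord eq_g' -[(_ * ln _) *+ _]mulr_natl [g%:R * _]mulrA -natrM.
  (* For g = 0 the conventions that 0 has inverse 0 and logarithm 0 settle the equality. *)
  have [g0|g_gt0] := posnP g; first by rewrite g0 !mul0n invr0 !mulr0 mul0r ln0 ?subr0.
  have e_gt0 : (0 < e)%N.
    by subst g'; rewrite -(e'E (Ordinal g_gt0)).
  have ge_neq0 : (g * e)%:R != 0 :> R by rewrite pnatr_eq0 muln_eq0 negb_or -!lt0n g_gt0.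
  rewrite mulKf // !natrM -mulf_div divff ?mul1r ?subrr //.
  by rewrite pnatr_eq0 -lt0n.
apply/seteqP; split=> [d|_ ->].
  move=> [g' [P [Q [e' [f' [facP facQ ->]]]]]].
  have [eq_g' e'E] := uniqP _ _ _ facP; have [_ f'E] := uniqQ _ _ _ facQ.
  by rewrite Omp Omq D0 //; case: facP.
(* The value 0 must also be attained: the factorizations found have the same length, so they can be
   paired. *)
have [P facP] := exP; have [Q facQ] := exQ.
exists g, P, Q, (fun=> e), (fun=> f); split=> //.
by rewrite Omp Omq D0 //; case: facP.
Qed.
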